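(* Let $q=2^m$ with $m\ge 4$ even. Let $\bar{\mathbb D}$ be the incidence structure with point set $U_{q+1}$ whose blocks are the sets $U_{q+1}\setminus B$ for $B\in \mathcal B_{q-4}(\mathrm{Tr}_{q^2/q}(\mathcal C_{\{3,5\}}))$. Then $\bar{\mathbb D}$ is isomorphic to the Witt spherical geometry design with parameters $3$-$(2^m+1,5,1)$, namely the design with point set $\mathrm{PG}(1,2^m)$ whose blocks are the images of the $5$-set $\mathrm{PG}(1,4)=\mathrm{GF}(4)\cup\{\infty\}$ under $\mathrm{PGL}_2(\mathrm{GF}(2^m))$.
   Context: $U_{q+1}$ is the set of $(q+1)$-th roots of unity in $\mathrm{GF}(q^2)$; coordinates are indexed by $U_{q+1}$. $\mathcal C_{\{3,5\}}=\{(a_3u^3+a_{q-2}u^{q-2}+a_5u^5+a_{q-4}u^{q-4})_{u\in U_{q+1}}: a_i\in\mathrm{GF}(q^2)\}$; $\mathrm{Tr}_{q^2/q}(\mathcal C)$ is obtained by applying $x\mapsto x+x^q$ coordinatewise. $\mathcal B_w(\mathcal C)$ is the set of supports of codewords of Hamming weight $w$. $\mathrm{GF}(4)\subseteq\mathrm{GF}(2^m)$ since $m$ is even, and $\mathrm{PGL}_2(\mathrm{GF}(2^m))$ acts on $\mathrm{PG}(1,2^m)=\mathrm{GF}(2^m)\cup\{\infty\}$ by linear fractional transformations. Two incidence structures are isomorphic if there is a bijection of point sets mapping the block set of one onto the block set of the other. *)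

(* Defs.v *)
From HB Require Import structures.
From mathcomp Require Import all_boot all_order all_algebra all_field.
Set Implicit Arguments. Unset Strict Implicit. Unset Printing Implicit Defensive.
Import GRing.Theory.
Local Open Scope ring_scope.

Section Code.
Variables (F : finFieldType) (q : nat).

(* U_{q+1}: the (q+1)-th roots of unity in GF(q^2) = F *)
Definition Uq1 : {set F} := [set u | u ^+ q.+1 == 1].

Definition trq (x : F) : F := x + x ^+ q.

Definition cw35 (a : F * F * F * F) (u : F) : F :=
  let: (a3, aq2, a5, aq4) := a in
  trq (a3 * u ^+ 3 + aq2 * u ^+ (q - 2) + a5 * u ^+ 5 + aq4 * u ^+ (q - 4)).

Definition supp35 (a : F * F * F * F) : {set F} :=
  [set u in Uq1 | cw35 a u != 0].

Definition Bw35 (w : nat) : {set {set F}} :=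
  [set supp35 a | a in [pred a | #|supp35 a| == w]].

Definition Dbar_blocks : {set {set F}} :=
  [set Uq1 :\: B | B in Bw35 (q - 4)].
End Code.

Section Witt.
Variable K : finFieldType.

(* PG(1,K) = K ∪ {∞}, with None = ∞ *)
Definition moebius (a b c d : K) (p : option K) : option K :=
  match p with
  | None => if c == 0 then None else Some (a / c)
  | Some x => if c * x + d == 0 then None else Some ((a * x + b) / (c * x + d))
  end.

Definition PG1_4 : {set option K} :=
  [set p | if p is Some x then x ^+ 4 == x else true].

Definition witt_blocks : {set {set option K}} :=
  [set [set moebius g.1.1.1 g.1.1.2 g.1.2 g.2 p | p in PG1_4]
   | g in [pred g : K * K * K * K | g.1.1.1 * g.2 - g.1.1.2 * g.1.2 != 0]].
End Witt.

Definition design_iso (F K : finType) (P1 : {set F}) (B1 : {set {set F}})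
  (B2 : {set {set K}}) : Prop :=
  exists f : F -> K,
    [/\ {in P1 &, injective f}, f @: P1 = [set: K] &
        [set f @: (B : {set F}) | B in B1] = B2].

(* Main.v *)
(** On [U_{q+1}] one has [u^q = 1/u], so a codeword is
    [u^(-5) (B u^10 + A u^8 + A^q u^2 + B^q)] with [A, B] arbitrary.  A Cayley map
    identifies [PG(1,q)] with [U_{q+1}], and in characteristic 2 a linear
    substitution preserves the shape
    [X^8 (k1 X^2 + k2 Y^2) + Y^8 (k3 X^2 + k4 Y^2)].
    If three zeros of a codeword are moved to [oo, 0, 1], the form becomes a
    multiple of
    [x^8 y^2 - x^2 y^8 = (x^4 y - x y^4)^2], whose zeros are exactly [PG(1,4)].
    Hence every nonzero codeword with at least three zeros vanishes exactly on a
    Moebius image of [PG(1,4)]; and since the pairs [(A, B)] form a space of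
    dimension 4 over GF(q) while values of codewords lie in GF(q), any three
    points are zeros of some nonzero codeword. *)

Require Import Defs.
From HB Require Import structures.
From mathcomp Require Import all_boot all_order all_fingroup all_algebra.
From mathcomp Require Import all_solvable all_field ring.
Set Implicit Arguments. Unset Strict Implicit. Unset Printing Implicit Defensive.
Import GRing.Theory.
Local Open Scope ring_scope.

(** * Fixed points of power maps, and forms of degree 10 in characteristic 2 *)

Lemma card_expr_fixed_le (F : finFieldType) (n : nat) :
  (1 < n)%N -> (#|[set x : F | x ^+ n == x]| <= n)%N.
Proof.
move=> n_gt1; set S := [set x | _].
have sz : size ('X^n - 'X : {poly F}) = n.+1.
  by rewrite size_polyDl size_polyXn // size_polyN size_polyX.
have nz : 'X^n - 'X != 0 :> {poly F} by rewrite -size_poly_gt0 sz.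
have := max_poly_roots nz _ (enum_uniq S); rewrite sz -cardE ltnS; apply.
by apply/allP=> x; rewrite mem_enum inE /root !hornerE subr_eq0.
Qed.

(** Bilinear in [(X^8, Y^8)] and [(X^2, Y^2)]; in characteristic 2 a linear substitution acts
    linearly on both pairs. *)
Definition dform (R : comNzRingType) (k : R * R * R * R) (X Y : R) : R :=
  X ^+ 8 * (k.1.1.1 * X ^+ 2 + k.1.1.2 * Y ^+ 2)
  + Y ^+ 8 * (k.1.2 * X ^+ 2 + k.2 * Y ^+ 2).

Lemma dformZ (R : comNzRingType) (k : R * R * R * R) (l X Y : R) :
  dform k (l * X) (l * Y) = l ^+ 10 * dform k X Y.
Proof. by rewrite /dform; ring. Qed.

(** After substitution only [x^10], [x^8 y^2], [x^2 y^8] and [y^10] can occur. The zeros at [(1, 0)]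
    and [(0, 1)] remove the pure powers; the zero at [(1, 1)] makes the other two coefficients
    opposite. *)
Lemma dform_subst (R : comNzRingType) (k : R * R * R * R) (a b c d : R) :
  2 \in [pchar R] ->
  let G x y := dform k (a * x + b * y) (c * x + d * y) in
  G 1 0 = 0 -> G 0 1 = 0 -> G 1 1 = 0 ->
  exists h, forall x y, G x y = h * (x ^+ 8 * y ^+ 2 - x ^+ 2 * y ^+ 8).
Proof.
move=> ch2 G.
have D2 u v : (u + v : R) ^+ 2 = u ^+ 2 + v ^+ 2.
  by rewrite exprDn_pchar // pnatE.
have D8 u v : (u + v : R) ^+ 8 = u ^+ 8 + v ^+ 8.
  by rewrite -[8%N]/(2 * 2 * 2)%N !exprM !D2.
case: k @G => [[[k1 k2] k3] k4] G.
pose g1 := a ^+ 8 * (k1 * a ^+ 2 + k2 * c ^+ 2)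
  + c ^+ 8 * (k3 * a ^+ 2 + k4 * c ^+ 2).
pose g2 := a ^+ 8 * (k1 * b ^+ 2 + k2 * d ^+ 2)
  + c ^+ 8 * (k3 * b ^+ 2 + k4 * d ^+ 2).
pose g3 := b ^+ 8 * (k1 * a ^+ 2 + k2 * c ^+ 2)
  + d ^+ 8 * (k3 * a ^+ 2 + k4 * c ^+ 2).
pose g4 := b ^+ 8 * (k1 * b ^+ 2 + k2 * d ^+ 2)
  + d ^+ 8 * (k3 * b ^+ 2 + k4 * d ^+ 2).
have GE x y : G x y = g1 * x ^+ 10 + g2 * (x ^+ 8 * y ^+ 2)
     + g3 * (x ^+ 2 * y ^+ 8) + g4 * y ^+ 10.
  by rewrite /G /dform /= !D2 !D8 /g1 /g2 /g3 /g4; ring.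
rewrite !GE !expr0n !expr1n /= !(mulr0, mulr1, mul0r, addr0, add0r) => g10 g40.
rewrite g10 g40 addr0 add0r => /eqP; rewrite addr_eq0 => /eqP g23.
by exists g2 => x y; rewrite GE g10 g40 g23; ring.
Qed.

(** * Moebius maps in homogeneous coordinates *)

Section ProjectiveLine.
Variable K : finFieldType.
Implicit Types p : option K.

Definition hcoord p : K * K := if p is Some x then (x, 1) else (1, 0).

Lemma moebius_hcoord (a b c d l : K) p p' : l != 0 ->
  a * (hcoord p).1 + b * (hcoord p).2 = l * (hcoord p').1 ->
  c * (hcoord p).1 + d * (hcoord p).2 = l * (hcoord p').2 ->
  moebius a b c d p = p'.
Proof.
move=> nzl; case: p => [x|] /=; rewrite ?mulr1 ?mulr0 ?addr0 => -> ->.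
  case: p' => [x'|] /=; rewrite ?mulr1 ?mulr0 ?eqxx ?(negPf nzl) //.
  by rewrite mulrC mulKf.
case: p' => [x'|] /=; rewrite ?mulr1 ?mulr0 ?eqxx ?(negPf nzl) //.
by rewrite mulrC mulKf.
Qed.

(** The scalar [l] is the denominator of the fraction or, when that vanishes, the numerator; the
    nonzero determinant prevents both from vanishing. *)
Lemma hcoord_moebius (a b c d : K) p : a * d - b * c != 0 ->
  exists2 l, l != 0 &
  a * (hcoord p).1 + b * (hcoord p).2 = l * (hcoord (moebius a b c d p)).1 /\
  c * (hcoord p).1 + d * (hcoord p).2 = l * (hcoord (moebius a b c d p)).2.
Proof.
move=> nzD; case: p => [x|] /=; rewrite ?mulr1 ?mulr0 ?addr0.
  have [e0|ne0] := eqVneq (c * x + d) 0; last first.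
    by exists (c * x + d) => //; split; rewrite ?mulr1 // [RHS]mulrC divfK.
  exists (a * x + b); last by rewrite mulr1 mulr0.
  apply: contraNneq nzD => e1; apply/eqP; have [c0|nzc] := eqVneq c 0.
    by rewrite c0 mulr0 subr0; move: e0; rewrite c0 mul0r add0r => ->; rewrite mulr0.
  apply: (mulfI nzc); rewrite mulr0.
  rewrite (_ : c * _ = a * c * (c * x + d) - c * c * (a * x + b)); last by ring.
  by rewrite e0 e1; ring.
have [c0|nzc] := eqVneq c 0; last first.
  by exists c => //; split; rewrite ?mulr1 // [RHS]mulrC divfK.
exists a; last by rewrite mulr1 mulr0.
by apply: contraNneq nzD => ->; rewrite c0; apply/eqP; ring.
Qed.

Lemma hcoord_neq0 p : hcoord p != (0, 0).
Proof. by case: p => [x|]; rewrite xpair_eqE /= oner_eq0 ?andbF. Qed.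

Lemma hcoord_det p p' :
  p != p' -> (hcoord p).1 * (hcoord p').2 - (hcoord p').1 * (hcoord p).2 != 0.
Proof.
case: p p' => [x|] [y|] //=; rewrite ?mulr1 ?mulr0 ?mul1r ?subr0 ?sub0r //.
- by rewrite subr_eq0.
- by rewrite oppr_eq0 oner_eq0.
- by rewrite oner_eq0.
Qed.

(** The determinant of two transformed coordinate vectors is [a * d - b * c] times the original one,
    and it vanishes when the images coincide. *)
Lemma moebius_inj (a b c d : K) :
  a * d - b * c != 0 -> injective (moebius a b c d).
Proof.
move=> nzD p p' e.
have [l nzl [e1 e2]] := hcoord_moebius p nzD.
have [l' nzl' [e1' e2']] := hcoord_moebius p' nzD.
rewrite -e in e1' e2'.
apply/eqP/contraT => /hcoord_det/eqP[]; apply: (mulfI nzD); rewrite mulr0.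
transitivity ((a * (hcoord p).1 + b * (hcoord p).2)
  * (c * (hcoord p').1 + d * (hcoord p').2)
  - (a * (hcoord p').1 + b * (hcoord p').2)
  * (c * (hcoord p).1 + d * (hcoord p).2)); first by ring.
by rewrite e1 e2 e1' e2'; ring.
Qed.

(* The columns represent [p1] and [p2], scaled by Cramer's rule so that their sum
   represents [p3]. *)
Lemma moebius_3transitive (p1 p2 p3 : option K) :
  p1 != p2 -> p1 != p3 -> p2 != p3 ->
  exists g : K * K * K * K, [/\ g.1.1.1 * g.2 - g.1.1.2 * g.1.2 != 0,
    moebius g.1.1.1 g.1.1.2 g.1.2 g.2 None = p1,
    moebius g.1.1.1 g.1.1.2 g.1.2 g.2 (Some 0) = p2 &
    moebius g.1.1.1 g.1.1.2 g.1.2 g.2 (Some 1) = p3].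
Proof.
move=> /hcoord_det + /hcoord_det + /hcoord_det.
set D12 := _ - _; set D13 := _ - _; set D23 := _ - _ => n12 n13 n23.
exists (- D23 * (hcoord p1).1, D13 * (hcoord p2).1,
        - D23 * (hcoord p1).2, D13 * (hcoord p2).2); split.
- rewrite /= (_ : _ - _ = - (D23 * D13 * D12)); last by rewrite /D12; ring.
  by rewrite oppr_eq0 !mulf_neq0.
- apply: (@moebius_hcoord _ _ _ _ (- D23)); rewrite ?oppr_eq0 //=.
    by rewrite mulr1 mulr0 addr0.
  by rewrite mulr1 mulr0 addr0.
- by apply: (@moebius_hcoord _ _ _ _ D13); rewrite //= mulr1 mulr0 add0r.
- by apply: (@moebius_hcoord _ _ _ _ D12); rewrite //= !mulr1 /D12 /D13 /D23; ring.
Qed.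
End ProjectiveLine.

(** * Embeddings of finite fields and the size of PG(1,4) *)

Lemma finField_generator (K : finFieldType) :
  exists z : K, forall y, y != 0 -> exists i, y = z ^+ i.
Proof.
have /cyclicP[x defU] := field_unit_group_cyclic [set: {unit K}]%G.
exists (val x) => y nzy.
have : finField_unit nzy \in <[x]>%g by rewrite -defU inE.
by case/cycleP=> i Di; exists i; rewrite -FinRing.val_unitX -Di.
Qed.

(* The minimal polynomial over GF(p) of a multiplicative generator of [K] divides
   [X^#|F| - X], hence has a root in [F]; the generator is sent to that root. *)
Lemma finField_embedding (p n k : nat) (K F : finFieldType) :
  prime p -> #|K| = (p ^ n)%N -> #|F| = (#|K| ^ k)%N ->
  inhabited {rmorphism K -> F}.
Proof.
move=> pr_p cardK cardF.
have chK : p \in [pchar K] := card_finPcharP cardK pr_p.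
have chF : p \in [pchar F].
  by apply: (@card_finPcharP _ p (n * k)); rewrite // expnM -cardK.
pose K' := pPrimeCharType chK; pose F' := pPrimeCharType chF.
have [z genK] := finField_generator K.
have /polyOver1P[mu Dmu] := minPolyOver 1 (z : K').
have kerK q : (map_poly (in_alg K') q).[z : K'] = 0 -> mu %| q.
  move=> qz0; rewrite -(dvdp_map (in_alg K')) -[X in X %| _]Dmu.
  apply: minPoly_dvdp; last exact/eqP.
  by apply/polyOver1P; exists q.
have [w w0] : exists w : F', root (map_poly (in_alg F') mu) w.
  have mu_dv : mu %| 'X^#|F| - 'X.
    apply: kerK; rewrite rmorphB /= map_polyXn map_polyX !hornerE.
    rewrite cardF; apply/eqP; rewrite subr_eq0; apply/eqP.
    elim: (k) => [|i IH]; rewrite ?expn0 ?expr1 // expnS mulnC exprM IH.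
    exact: expf_card.
  have : map_poly (in_alg F') mu %| \prod_(x : F) ('X - x%:P).
    rewrite -finField_genPoly.
    have := mu_dv; rewrite -(dvdp_map (in_alg F')).
    by rewrite rmorphB /= map_polyXn map_polyX.
  (* Up to a unit, [mu] is a product of linear factors, at least one because a minimal polynomial
     has positive degree. *)
  case/dvdp_prod_XsubC=> s mu_eq; have := eqp_size mu_eq.
  rewrite size_map_poly -(size_map_poly (in_alg K')) -Dmu size_minPoly.
  move: mu_eq; case: (mask _ _) => [|w t] mu_eq; first by rewrite big_nil size_poly1.
  by exists w; rewrite (eqp_root mu_eq) root_prod_XsubC inE eqxx.
have kerF q : (map_poly (in_alg K') q).[z : K'] = 0 ->
    (map_poly (in_alg F') q).[w] = 0.
  move/kerK/dvdpP=> [r ->]; rewrite rmorphM hornerM (rootP w0).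
  exact: mulr0.
have surj (y : K') : exists q, (map_poly (in_alg K') q).[z : K'] == y.
  have [->|/genK[i ->]] := eqVneq y 0; first by exists 0; rewrite rmorph0 horner0.
  by exists 'X^i; rewrite map_polyXn hornerXn.
(* Write [y] as a polynomial in [z] and evaluate it at [w]; [kerF] makes the value independent of
   the polynomial chosen. *)
pose f (y : K') : F' := (map_poly (in_alg F') (xchoose (surj y))).[w].
have fE q y : (map_poly (in_alg K') q).[z : K'] = y ->
    f y = (map_poly (in_alg F') q).[w].
  move=> Dy; apply/eqP; rewrite -subr_eq0 -hornerN -hornerD -rmorphB.
  apply/eqP/kerF; rewrite rmorphB hornerD hornerN Dy.
  by rewrite (eqP (xchooseP (surj y))) subrr.
have fB : zmod_morphism (f : K -> F).
  move=> x y; pose X := xchoose (surj x); pose Y := xchoose (surj y).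
  rewrite (fE (X - Y)) ?rmorphB ?hornerD ?hornerN //.
  by rewrite (eqP (xchooseP (surj x))) (eqP (xchooseP (surj y))).
have fM : monoid_morphism (f : K -> F).
  split=> [|x y]; first by rewrite (fE 1) rmorph1 hornerC.
  pose X := xchoose (surj x); pose Y := xchoose (surj y).
  rewrite (fE (X * Y)) ?rmorphM ?hornerM //.
  by rewrite (eqP (xchooseP (surj x))) (eqP (xchooseP (surj y))).
pose fA := GRing.isZmodMorphism.Build K F f fB.
pose fR := GRing.isMonoidMorphism.Build K F f fM.
pose fF : {rmorphism K -> F} := HB.pack (f : K -> F) fA fR.
by constructor.
Qed.

(** [X^4 - X] has at most four roots, and an embedded copy of GF(4) supplies four; infinity is the
    fifth point. *)
Lemma card_PG1_4 (K : finFieldType) (n : nat) : #|K| = (4 ^ n)%N -> #|PG1_4 K| = 5.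
Proof.
move=> cardK.
have [F4 _ card4] := pPrimePowerField (isT : prime 2) (isT : 0 < 2)%N.
have [iota] := finField_embedding (isT : prime 2) card4
  (etrans cardK (congr1 (expn^~ n) (esym card4))).
have -> : PG1_4 K = None |: Some @: [set x : K | x ^+ 4 == x].
  apply/setP=> -[x|]; rewrite !inE //=.
  by rewrite (mem_imset _ _ Some_inj) inE.
rewrite cardsU1 card_imset; last exact: Some_inj.
rewrite (_ : None \notin _) ?add1n; last by apply/imsetP=> -[].
congr _.+1; apply/eqP; rewrite eqn_leq card_expr_fixed_le //=.
have := subset_leq_card (_ : iota @: [set: F4] \subset [set x : K | x ^+ 4 == x]).
rewrite (card_imset _ (fmorph_inj iota)) cardsT card4; apply.
apply/subsetP=> _ /imsetP[x _ ->]; rewrite inE -rmorphXn.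
by rewrite -[X in x ^+ X]card4 expf_card.
Qed.

(** * Codewords as binary forms *)

Section CodeZeros.
Variables (m : nat) (F K : finFieldType).
Hypotheses (m_ge4 : (4 <= m)%N) (cardF : #|F| = ((2 ^ m) ^ 2)%N)
  (cardK : #|K| = (2 ^ m)%N).
Local Notation q := (2 ^ m)%N.

Let q_ge16 : (16 <= q)%N. Proof. by rewrite (@leq_pexp2l 2 4). Qed.

Let ch2 : 2 \in [pchar F].
Proof. by apply: (@card_finPcharP _ 2 (m * 2)); rewrite // expnM. Qed.

Let frobD (x y : F) : (x + y) ^+ q = x ^+ q + y ^+ q.
Proof. by rewrite exprDn_pchar // pnatX pnatE // ch2. Qed.

Let frobK (x : F) : (x ^+ q) ^+ q = x.
Proof. by rewrite -exprM mulnn -cardF expf_card. Qed.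

Lemma trq_fixed (x : F) : trq q x ^+ q = trq q x.
Proof. by rewrite /trq frobD frobK addrC. Qed.

Lemma Uq1P (u : F) : reflect (u ^+ q * u = 1) (u \in Uq1 F q).
Proof. by rewrite inE exprSr; apply: eqP. Qed.

Lemma Uq1_neq0 (u : F) : u \in Uq1 F q -> u != 0.
Proof. by move/Uq1P; apply: contra_eqN => /eqP->; rewrite mulr0 eq_sym oner_eq0. Qed.

(** [A] and [B] are the coefficients of [u^3] and [u^5] once the trace is expanded on [U_{q+1}];
    tuples [(A, 0, B, 0)] already reach every pair. *)
Definition cw35_coefs (a : F * F * F * F) : F * F * F * F :=
  let A := a.1.1.1 + a.1.1.2 ^+ q in let B := a.1.2 + a.2 ^+ q in
  (B, A, A ^+ q, B ^+ q).

(** Since [u^q = 1/u], the exponents [q - 2] and [q - 4] act as -3 and -5, and the factor [u^5]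
    clears the denominators. *)
Lemma cw35_dform (a : F * F * F * F) (u : F) : u \in Uq1 F q ->
  u ^+ 5 * cw35 q a u = dform (cw35_coefs a) u 1.
Proof.
case: a => [[[a3 a2] a5] a4] /Uq1P uq.
have e2 : u ^+ (q - 2) = (u ^+ q) ^+ 3.
  rewrite -[LHS]mulr1 -(expr1n _ 2) -uq exprMn mulrCA -exprD subnK -?exprSr //.
  exact: leq_trans q_ge16.
have e4 : u ^+ (q - 4) = (u ^+ q) ^+ 5.
  rewrite -[LHS]mulr1 -(expr1n _ 4) -uq exprMn mulrCA -exprD subnK -?exprSr //.
  exact: leq_trans q_ge16.
have nzu : u != 0 by apply: contra_eqN uq => /eqP->; rewrite mulr0 eq_sym oner_eq0.
have vE : u ^+ q = u^-1 by rewrite -[RHS]mul1r -uq mulfK.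
have uX b n : (b * u ^+ n) ^+ q = b ^+ q * u^-1 ^+ n by rewrite exprMn exprAC vE.
have vX b n : (b * u^-1 ^+ n) ^+ q = b ^+ q * u ^+ n.
  by rewrite exprMn exprAC -vE frobK.
rewrite /cw35 /cw35_coefs /dform /= e2 e4 vE /trq !frobD !uX !vX !frobK.
by field.
Qed.

Lemma cw35_eq0 (a : F * F * F * F) (X Y : F) : Y != 0 -> X / Y \in Uq1 F q ->
  (cw35 q a (X / Y) == 0) = (dform (cw35_coefs a) X Y == 0).
Proof.
move=> nzY Uu; rewrite -[X in dform _ X _](divfK nzY) -[Y in dform _ _ Y]mulr1.
rewrite [_ / _ * Y]mulrC dformZ -cw35_dform //.
by rewrite mulf_eq0 expf_eq0 (negPf nzY) /= mulf_eq0 expf_eq0 (negPf (Uq1_neq0 Uu)).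
Qed.

(** Otherwise a polynomial of degree at most 10 would have [q + 1 > 10] roots, forcing its
    coefficients [A] and [B] to vanish. *)
Lemma cw35_not_identically_zero (A B : F) : #|Uq1 F q| = q.+1 -> (A, B) != (0, 0) ->
  exists2 u, u \in Uq1 F q & cw35 q (A, 0, B, 0) u != 0.
Proof.
move=> cardU nz; apply/exists_inP; apply: contraR nz => /exists_inPn cw0.
pose s := [:: B ^+ q; 0; A ^+ q; 0; 0; 0; 0; 0; A; 0; B].
have s0 : Poly s = 0.
  apply/eqP; apply: contraLR (size_Poly s) => nz; rewrite -ltnNge.
  apply: leq_trans (max_poly_roots nz _ (enum_uniq (Uq1 F q))).
    by rewrite -cardE cardU !ltnS; apply: leq_trans q_ge16.
  apply/allP=> u; rewrite mem_enum => Uu; rewrite /root horner_Poly.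
  have := cw35_dform (A, 0, B, 0) Uu; have /negPn/eqP-> := cw0 u Uu.
  rewrite mulr0 /dform /cw35_coefs /= => e; apply/eqP.
  rewrite [RHS]e expr0n gtn_eqF ?(leq_trans _ q_ge16) // !addr0; ring.
have /(congr1 (fun p : {poly F} => p`_8)) := s0.
have /(congr1 (fun p : {poly F} => p`_10)) := s0.
by rewrite !coef_Poly !coef0 /= => -> ->.
Qed.

(* Codewords take values in the fixed field of [x^q], of size q, so the q^4 pairs
   have at most q^3 value triples: two pairs agree, and their difference works. *)
Lemma cw35_common_zeros (u1 u2 u3 : F) :
  exists2 AB : F * F, AB != (0, 0) &
   [/\ cw35 q (AB.1, 0, AB.2, 0) u1 = 0, cw35 q (AB.1, 0, AB.2, 0) u2 = 0
      & cw35 q (AB.1, 0, AB.2, 0) u3 = 0].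
Proof.
pose S := [set x : F | x ^+ q == x].
have cardS : (#|S| <= q)%N by apply: card_expr_fixed_le; apply: leq_trans q_ge16.
pose c (AB : F * F) u := cw35 q (AB.1, 0, AB.2, 0) u.
have cS AB u : c AB u \in S by rewrite inE /c /= trq_fixed.
pose phi AB := (c AB u1, c AB u2, c AB u3).
have /injectivePn[x [y nxy phixy]] : ~~ injectiveb phi.
  apply/negP=> /injectiveP inj_phi.
  have := card_imset [set: F * F] inj_phi; rewrite cardsT card_prod cardF.
  have sub : phi @: [set: F * F] \subset setX (setX S S) S.
    by apply/subsetP=> _ /imsetP[x _ ->]; rewrite !in_setX !cS.
  have := subset_leq_card sub; rewrite !cardsX => /[swap] ->.
  rewrite leqNgt; case/negP; apply: (@leq_ltn_trans (q * q * q)).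
    by rewrite !leq_mul.
  have q_gt0 : (0 < q)%N by apply: leq_trans q_ge16.
  rewrite -!mulnn ltn_pmul2l ?muln_gt0 ?q_gt0 // ltn_Pmull //.
  exact: leq_trans q_ge16.
have cB u : c (x.1 - y.1, x.2 - y.2) u = c x u - c y u.
  have fN (z : F) : (- z) ^+ q = - z ^+ q.
    apply/eqP; rewrite -subr_eq0 opprK -frobD addNr expr0n gtn_eqF //.
    exact: leq_trans q_ge16.
  rewrite /c /cw35 /= !mul0r !addr0 /trq !mulrBl !frobD !fN; ring.
exists (x.1 - y.1, x.2 - y.2).
  apply: contra nxy => /eqP[/eqP + /eqP]; rewrite !subr_eq0.
  by case: x y {phixy cB} => [? ?] [? ?] /= /eqP-> /eqP->.
by case: phixy => e1 e2 e3; split; rewrite -/(c _ _) cB ?e1 ?e2 ?e3 subrr.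
Qed.

Lemma exists_not_fixed : exists t : F, t ^+ q != t.
Proof.
apply/existsP; apply: contraT; rewrite negb_exists => /forallP fixed.
have : (#|[set x : F | x ^+ q == x]| <= q)%N.
  by apply: card_expr_fixed_le; apply: leq_trans q_ge16.
rewrite (_ : [set x | _] = setT); last first.
  by apply/setP=> x; rewrite !inE; apply/negPn/fixed.
rewrite cardsT cardF -mulnn leqNgt ltn_Pmull //; exact: leq_trans q_ge16.
Qed.

(** * The Cayley map and the zero sets of codewords *)

Variable iota : {rmorphism K -> F}.

Let iota_frob (x : K) : (iota x) ^+ q = iota x.
Proof. by rewrite -rmorphXn -cardK expf_card. Qed.

(* As [t] lies outside GF(q), the Cayley fraction below never has a zero
   numerator or denominator. *)
Variable t : F.
Hypothesis t_nfix : t ^+ q != t.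

Definition cayley (p : option K) : F :=
  (iota (hcoord p).1 + t * iota (hcoord p).2)
  / (iota (hcoord p).1 + t ^+ q * iota (hcoord p).2).

(** If the sum vanished with [y] nonzero, [s] would be [iota (- (x / y))], which the [q]-th power
    fixes. *)
Lemma iota_comb_neq0 (s : F) (x y : K) : s ^+ q != s -> (x, y) != (0, 0) ->
  iota x + s * iota y != 0.
Proof.
move=> s_nfix; apply: contra => /eqP e.
have [y0|nzy] := eqVneq y 0.
  by move/eqP: e; rewrite y0 rmorph0 mulr0 addr0 fmorph_eq0 => /eqP->.
case/eqP: s_nfix; have -> : s = iota (- (x / y)).
  rewrite rmorphN fmorph_div /=; apply: (mulIf (_ : iota y != 0)).
    by rewrite fmorph_eq0.
  by rewrite mulNr divfK ?fmorph_eq0 //; apply/eqP; rewrite -addr_eq0 addrC e.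
exact: iota_frob.
Qed.

Let tq_nfix : (t ^+ q) ^+ q != t ^+ q.
Proof. by rewrite frobK eq_sym. Qed.

Lemma num_neq0 (p : option K) : iota (hcoord p).1 + t * iota (hcoord p).2 != 0.
Proof. by apply: iota_comb_neq0; rewrite // -surjective_pairing hcoord_neq0. Qed.

Lemma den_neq0 (p : option K) :
  iota (hcoord p).1 + t ^+ q * iota (hcoord p).2 != 0.
Proof. by apply: iota_comb_neq0; rewrite // -surjective_pairing hcoord_neq0. Qed.

(** The [q]-th power swaps numerator and denominator, hence inverts the fraction. *)
Lemma cayley_Uq1 (p : option K) : cayley p \in Uq1 F q.
Proof.
apply/Uq1P; rewrite /cayley expr_div_n !frobD !exprMn !iota_frob frobK.
by rewrite mulrA divfK ?num_neq0 // divff // den_neq0.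
Qed.

(** Cross-multiplying two equal fractions leaves [t^q - t] times the determinant of the two
    coordinate vectors. *)
Lemma cayley_inj : injective cayley.
Proof.
move=> p p' /eqP; rewrite /cayley eqr_div ?den_neq0 // => /eqP e.
apply/eqP/contraT => /hcoord_det; rewrite -(fmorph_eq0 iota) => /eqP[].
apply: (mulfI (_ : t ^+ q - t != 0)); first by rewrite subr_eq0.
move/eqP: e; rewrite mulr0 -subr_eq0 => /eqP <-.
by rewrite rmorphB !rmorphM /=; ring.
Qed.

Lemma cayley_onto : cayley @: [set: option K] = Uq1 F q.
Proof.
apply/eqP; rewrite eqEcard; apply/andP; split.
  by apply/subsetP=> _ /imsetP[p _ ->]; apply: cayley_Uq1.
rewrite card_imset ?cardsT ?card_option ?cardK; last exact: cayley_inj.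
rewrite cardE; apply: (@max_unity_roots F) => //; last exact: enum_uniq.
by apply/allP=> u; rewrite mem_enum inE unity_rootE.
Qed.

Lemma card_Uq1 : #|Uq1 F q| = q.+1.
Proof.
by rewrite -cayley_onto card_imset ?cardsT ?card_option ?cardK //; exact: cayley_inj.
Qed.

Lemma cw35_zeros_moebius (a : F * F * F * F) (g1 g2 g3 g4 : K) :
  g1 * g4 - g2 * g3 != 0 ->
  cw35 q a (cayley (moebius g1 g2 g3 g4 None)) = 0 ->
  cw35 q a (cayley (moebius g1 g2 g3 g4 (Some 0))) = 0 ->
  cw35 q a (cayley (moebius g1 g2 g3 g4 (Some 1))) = 0 ->
  (exists2 u, u \in Uq1 F q & cw35 q a u != 0) ->
  [set u in Uq1 F q | cw35 q a u == 0] =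
    cayley @: (moebius g1 g2 g3 g4 @: PG1_4 K).
Proof.
move=> nzD; have := moebius_inj nzD; have := fun p => hcoord_moebius p nzD.
set M := moebius _ _ _ _; move: M => M hM M_inj.
(* [G] is the form of the codeword pulled back along the Moebius map followed by the Cayley map. *)
pose G x y := dform (cw35_coefs a)
  ((iota g1 + t * iota g3) * x + (iota g2 + t * iota g4) * y)
  ((iota g1 + t ^+ q * iota g3) * x + (iota g2 + t ^+ q * iota g4) * y).
have cwG p : (cw35 q a (cayley (M p)) == 0) =
    (G (iota (hcoord p).1) (iota (hcoord p).2) == 0).
  rewrite /cayley cw35_eq0 ?den_neq0 //; last exact: cayley_Uq1.
  have [l nzl [e1 e2]] := hM p.
  have lin s : (iota g1 + s * iota g3) * iota (hcoord p).1
     + (iota g2 + s * iota g4) * iota (hcoord p).2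
     = iota l * (iota (hcoord (M p)).1 + s * iota (hcoord (M p)).2).
    transitivity (iota (g1 * (hcoord p).1 + g2 * (hcoord p).2)
      + s * iota (g3 * (hcoord p).1 + g4 * (hcoord p).2)).
      by rewrite !rmorphD !rmorphM /=; ring.
    by rewrite e1 e2 !rmorphM /=; ring.
  by rewrite /G !lin dformZ mulf_eq0 expf_eq0 fmorph_eq0 (negPf nzl).
move=> z1 z2 z3.
have := cwG None; have := cwG (Some 0); have := cwG (Some 1).
rewrite z1 z2 z3 !eqxx /= rmorph0 rmorph1.
move=> /esym/eqP g3E /esym/eqP g2E /esym/eqP g1E.
have [h hE] := dform_subst ch2 g1E g2E g3E.
have M_onto p : exists p', p = M p' by apply/codomP/injF_onto.
have cwh p : (cw35 q a (cayley (M p)) == 0) =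
    (h * (iota (hcoord p).1 ^+ 8 * iota (hcoord p).2 ^+ 2
      - iota (hcoord p).1 ^+ 2 * iota (hcoord p).2 ^+ 8) == 0).
  by rewrite cwG /G hE.
(* A point where the codeword is nonzero forces [h] to be nonzero. *)
case=> u; rewrite -cayley_onto => /imsetP[p0 _ ->].
have [p1 ->] := M_onto p0; rewrite cwh mulf_eq0 => /norP[nzh _].
have ch2K : 2 \in [pchar K] := card_finPcharP cardK isT.
have cwPG p : (cw35 q a (cayley (M p)) == 0) = (p \in PG1_4 K).
  rewrite cwh mulf_eq0 (negPf nzh) inE; case: p => [x|] /=.
    rewrite rmorph1 !expr1n !mulr1 -!rmorphXn -rmorphB fmorph_eq0.
    (* Squaring is injective in characteristic 2, so [x^8 = x^2] amounts to [x^4 = x]. *)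
    rewrite -[8%N]/(4 * 2)%N exprM subr_eq0 -!(pFrobenius_autE ch2K).
    by rewrite (inj_eq (fmorph_inj _)).
  by rewrite rmorph0 !expr0n !mulr0 subrr eqxx.
apply/setP=> v; rewrite in_set; apply/andP/imsetP.
  case=> /imsetP[p _ ->]; have [p' ->] := M_onto p; rewrite cwPG => p'4.
  by exists (M p') => //; apply: imset_f.
case=> _ /imsetP[p p4 ->] ->; split; first by apply: imset_f; rewrite inE.
by rewrite cwPG.
Qed.

End CodeZeros.

(* The isomorphism of designs *)
Local Close Scope ring_scope.

Theorem theorem26 (m : nat) (F K : finFieldType) :
  (4 <= m)%N -> ~~ odd m ->
  #|F| = (2 ^ m) ^ 2 ->
  #|K| = 2 ^ m ->
  design_iso (Uq1 F (2 ^ m)) (Dbar_blocks F (2 ^ m)) (witt_blocks K).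
Proof.
move=> m_ge4 m_even cardF cardK; set q := (2 ^ m)%N.
have [iota] := finField_embedding (isT : prime 2) cardK
  (etrans cardF (congr1 (expn^~ 2) (esym cardK))).
have [t t_nfix] := exists_not_fixed m_ge4 cardF.
pose psi := cayley m iota t.
have psi_inj : injective psi := cayley_inj cardF cardK t_nfix.
have psi_onto : psi @: setT = Uq1 F q := cayley_onto cardF cardK iota t_nfix.
have cardU : #|Uq1 F q| = q.+1 := card_Uq1 cardF cardK iota t_nfix.
have q_gt4 : 4 < q by apply: (@leq_trans 16); rewrite ?(@leq_pexp2l 2 4).
(* [f] inverts the Cayley map; the default [None] is returned only outside [U_{q+1}]. *)
pose f u := odflt None [pick p | psi p == u].
have psiK : cancel psi f.
  rewrite /f => p; case: pickP => [p' /eqP/psi_inj -> //|/(_ p)].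
  by rewrite eqxx.
have imK (T : {set option K}) : f @: (psi @: T) = T.
  by rewrite -imset_comp (eq_imset _ psiK) imset_id.
pose Z a := [set u in Uq1 F q | cw35 q a u == 0%R].
have suppE a : Uq1 F q :\: supp35 q a = Z a.
  apply/setP=> u; rewrite in_setD [in RHS]in_set [u \in supp35 _ _]in_set.
  by case: (u \in Uq1 F q); rewrite ?andbF ?andbT ?negbK.
have sub_supp a : supp35 q a \subset Uq1 F q.
  by apply/subsetP=> u; rewrite in_set => /andP[].
have cardZ a : (#|Z a| + #|supp35 q a| = q.+1)%N.
  rewrite -suppE -cardU -(cardsID (supp35 q a) (Uq1 F q)) addnC.
  by rewrite (setIidPr (sub_supp a)).
(* As [q + 1 = 5 + (q - 4)], weight [q - 4] means exactly five zeros. *)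
have card5 a : (#|Z a| == 5) = (#|supp35 q a| == q - 4).
  rewrite -(eqn_add2r #|supp35 q a|) cardZ -{1}(subnK (ltnW q_gt4)) -addnS.
  by rewrite [5 + _]addnC eqn_add2r eq_sym.
have zerosP a g : (g.1.1.1 * g.2 - g.1.1.2 * g.1.2 != 0)%R ->
    cw35 q a (psi (moebius g.1.1.1 g.1.1.2 g.1.2 g.2 None)) = 0%R ->
    cw35 q a (psi (moebius g.1.1.1 g.1.1.2 g.1.2 g.2 (Some 0%R))) = 0%R ->
    cw35 q a (psi (moebius g.1.1.1 g.1.1.2 g.1.2 g.2 (Some 1%R))) = 0%R ->
    (exists2 u, u \in Uq1 F q & cw35 q a u != 0%R) ->
    Z a = psi @: (moebius g.1.1.1 g.1.1.2 g.1.2 g.2 @: PG1_4 K).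
  exact: (cw35_zeros_moebius m_ge4 cardF cardK t_nfix).
exists f; split.
- move=> u v; rewrite -psi_onto => /imsetP[p _ ->] /imsetP[p' _ ->].
  by rewrite !psiK => ->.
- by rewrite -psi_onto imK.
apply/setP=> T; apply/imsetP/imsetP.
  case=> _ /imsetP[_ /imsetP[a wa ->] ->] ->; rewrite suppE.
  (* Three of the five zeros determine a Moebius map sending infinity, 0, 1 to them, which makes the
     block an image of PG(1,4). *)
  have /card_gt2P[u1 [u2 [u3 [[Zu1 Zu2 Zu3] [n12 n23 n31]]]]] : (2 < #|Z a|)%N.
    by move: wa; rewrite inE -card5 => /eqP->.
  have psiZ u : u \in Z a -> exists2 p, u = psi p & cw35 q a (psi p) = 0%R.
    by rewrite in_set -psi_onto => /andP[/imsetP[p _ ->] /eqP]; exists p.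
  have [p1 Du1 z1] := psiZ _ Zu1; have [p2 Du2 z2] := psiZ _ Zu2.
  have [p3 Du3 z3] := psiZ _ Zu3.
  move: n12 n23 n31; rewrite Du1 Du2 Du3 !(inj_eq psi_inj) => n12 n23 n31.
  rewrite eq_sym in n31.
  have [g [nzD g1 g2 g3]] := moebius_3transitive n12 n31 n23.
  exists g => //; rewrite (zerosP a g) ?g1 ?g2 ?g3 ?imK //.
  have /card_gt0P[u] : (0 < #|supp35 q a|)%N.
    by move: wa; rewrite inE => /eqP->; rewrite subn_gt0.
  by rewrite in_set => /andP[]; exists u.
case=> g nzD ->; set M := moebius _ _ _ _.
(* Conversely, take a nonzero codeword vanishing at the images of infinity, 0 and 1; its zero set is
   then the given block. *)
have [AB nzAB [z1 z2 z3]] := cw35_common_zeros m_ge4 cardF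
  (psi (M None)) (psi (M (Some 0%R))) (psi (M (Some 1%R))).
set a := (AB.1, 0%R, AB.2, 0%R) in z1 z2 z3.
have nz : exists2 u, u \in Uq1 F q & cw35 q a u != 0%R.
  apply: (cw35_not_identically_zero m_ge4 cardF cardU).
  by rewrite -surjective_pairing.
have Za := zerosP a g nzD z1 z2 z3 nz.
exists (Z a); last by rewrite Za imK.
rewrite -suppE; apply: imset_f; apply: imset_f; rewrite inE -card5.
rewrite Za card_imset // card_imset; last exact: moebius_inj.
(* Evenness of [m] enters here: [2^m = 4^(m/2)]. *)
apply/eqP/(@card_PG1_4 _ m./2); rewrite cardK.
by rewrite -[4]/(2 ^ 2) -expnM mul2n even_halfK.
Qed.
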